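(* Let $n\ge 1$, let $\mu\in\mathbb{R}^n$, and let $X\sim\mathcal{N}(\mu,\Sigma_0)$ and $Y\sim\mathcal{N}(\mu,\Sigma_1)$ be $n$-variate normal random vectors with the same expectation $\mu$ and covariance matrices $\Sigma_0$ and $\Sigma_1$, respectively. Denote by $P_X$ and $P_Y$ the corresponding probability measures (laws) on $\mathbb{R}^n$. Assume $0<C\Sigma_0\le\Sigma_1$ for some constant $0<C\le 1$. Then $$d_K(P_Y,P_X)\;\le\;\frac{1}{4C^2}\left\|\Sigma_0^{-1/2}(\Sigma_1-\Sigma_0)\Sigma_0^{-1/2}\right\|_F^2\;\le\;\frac{1}{4C^2}\left\|\Sigma_0^{-1}\Sigma_1-I_n\right\|_F^2 .$$
   Context: The Kullback-Leibler divergence between probability measures $P,Q$ is $d_K(P,Q):=\int\log\left(\frac{dP}{dQ}\right)dP$ if $P\ll Q$, and $+\infty$ otherwise (here $\log$ is the natural logarithm). Inequalities between symmetric matrices are in the Loewner order: $A\le B$ means $B-A$ is positive semidefinite, and $0<A$ means $A$ is positive definite. $I_n$ is the $n\times n$ identity matrix, and $\|A\|_F:=\left(\operatorname{tr}(AA^t)\right)^{1/2}$ is the Frobenius norm. *)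

(* Defs.v *)
From HB Require Import structures.
From mathcomp Require Import all_boot all_order all_algebra.
From mathcomp Require Import all_classical all_reals all_analysis.

Set Implicit Arguments.
Unset Strict Implicit.
Unset Printing Implicit Defensive.

Import Order.TTheory GRing.Theory Num.Theory.
Import numFieldNormedType.Exports.

Local Open Scope classical_set_scope.
Local Open Scope ring_scope.

Section matrices.
Variables (R : realType) (n : nat).
Implicit Types A B S : 'M[R]_n.

Definition posdefmx A : Prop :=
  A^T = A /\ forall x : 'cV[R]_n, x != 0 -> 0 < (x^T *m A *m x) 0 0.

Definition possemidefmx A : Prop :=
  A^T = A /\ forall x : 'cV[R]_n, 0 <= (x^T *m A *m x) 0 0.

Definition loewner_le A B : Prop := possemidefmx (B - A).

(* A positive semidefinite matrix has exactly one positive semidefinite square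
   root; [sqrtmx A] is meaningful for such [A] only. *)
Definition sqrtmx A : 'M[R]_n :=
  xget 0 [set S : 'M[R]_n | possemidefmx S /\ S *m S = A].

Definition frobenius_norm A : R := Num.sqrt (\tr (A *m A^T)).

End matrices.

Section lebesgue_tuple.
Variable R : realType.

Local Notation E n := (n.-tuple (measurableTypeR R)).

Definition tcons n (p : measurableTypeR R * E n) : E n.+1 :=
  [tuple of p.1 :: p.2].

Lemma measurable_tcons n :
  measurable_fun [set: measurableTypeR R * E n] (@tcons n).
Proof. exact: measurable_cons. Qed.

Section step.
Variable n : nat.
Variable m : {sigma_finite_measure set (E n) -> \bar R}.

Definition lebesgue_tcons : set (E n.+1) -> \bar R :=
  pushforward (@lebesgue_measure R \x m)%E (@tcons n).

HB.instance Definition _ := Measure.copy lebesgue_tcons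
  (measure_function_pushforward__canonical__measure_function_Measure
     (@lebesgue_measure R \x m)%E (@measurable_tcons n)).

Lemma lebesgue_tcons_sigma_finite : sigma_finite setT lebesgue_tcons.
Proof.
have /sigma_finiteP[F [FT ndF Foo]] := sigma_finiteT (@lebesgue_measure R).
have /sigma_finiteP[G [GT ndG Goo]] := sigma_finiteT m.
pose g (t : E n.+1) : measurableTypeR R * E n := (thead t, [tuple of behead t]).
have mg : measurable_fun setT g.
  by apply/measurable_fun_pair;
    [exact: measurable_tnth|exact: measurable_behead].
have gK : cancel (@tcons n) g.
  by move=> [x t]; rewrite /g /tcons theadE; congr pair; apply/val_inj.
exists (fun k => g @^-1` (F k `*` G k)).
  rewrite -preimage_bigcup -(preimage_setT g); congr (_ @^-1` _).
  apply/seteqP; split=> // -[x t] _.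
  have [i _ Fx] : (\bigcup_i F i) x by rewrite -FT.
  have [j _ Gt] : (\bigcup_i G i) t by rewrite -GT.
  exists (maxn i j) => //; split => /=.
  - by move: x Fx; exact/subsetPset/ndF/leq_maxl.
  - by move: t Gt; exact/subsetPset/ndG/leq_maxr.
move=> k; have [mF Fk] := Foo k; have [mG Gk] := Goo k; split.
  by rewrite -[_ @^-1` _]setTI; apply: mg => //; exact: measurableX.
rewrite /lebesgue_tcons /pushforward.
rewrite -comp_preimage (_ : g \o @tcons n = id); last exact/funext.
by rewrite preimage_id product_measure1E// lte_mul_pinfty// ge0_fin_numE.
Qed.

HB.instance Definition _ := Measure_isSigmaFinite.Build _ _ _ lebesgue_tcons
  lebesgue_tcons_sigma_finite.

End step.

(* Lebesgue measure on R^n, the latter being [n.-tuple (measurableTypeR R)] with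
   its product (that is, Borel) sigma-algebra: the n-fold product of the
   one-dimensional Lebesgue measure, transported along [tcons]. *)
Fixpoint lebesgue_tuple n : {sigma_finite_measure set (E n) -> \bar R} :=
  match n with
  | 0 => dirac [tuple]
  | k.+1 => lebesgue_tcons (lebesgue_tuple k)
  end.

End lebesgue_tuple.

Section normal_law.
Variables (R : realType) (n : nat).

Definition col_of_tuple (x : n.-tuple R) : 'cV[R]_n := \col_i tnth x i.

Definition multinormal_pdf (mu : 'cV[R]_n) (Sigma : 'M[R]_n)
    (x : n.-tuple R) : R :=
  let y := col_of_tuple x - mu in
  (Num.sqrt ((2 * pi) ^+ n * \det Sigma))^-1 *
  expR (- ((y^T *m invmx Sigma *m y) 0 0) / 2).

(* X ~ N(mu, Sigma) with Sigma nonsingular. *)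
Definition multinormal d (T : measurableType d) (P : probability T R)
    (X : {RV P >-> n.-tuple (measurableTypeR R)}) (mu : 'cV[R]_n) (Sigma : 'M[R]_n) : Prop :=
  posdefmx Sigma /\
  forall A : set (n.-tuple (measurableTypeR R)), measurable A ->
    distribution P X A =
    (\int[@lebesgue_tuple R n]_(x in A) (multinormal_pdf mu Sigma x)%:E)%E.

End normal_law.

Section kullback_leibler.
Local Open Scope charge_scope.
Local Open Scope ereal_scope.

(* The value of [lne] at nonpositive arguments (namely -oo) is irrelevant: the
   density is positive P-almost everywhere. *)
Definition kl_div d (T : measurableType d) (R : realType)
    (P Q : probability T R) : \bar R :=
  if `[< P `<< Q >] then
    \int[P]_x lne (('d (charge_of_finite_measure P) '/d Q) x)
  else +oo.

End kullback_leibler.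

(* Main.v *)
Require Import Defs.
From mathcomp Require Import all_boot all_order all_algebra.
From mathcomp Require Import spectral sesquilinear complex ring lra.
From mathcomp Require Import all_classical all_reals all_analysis.
From mathcomp Require Import measurable_realfun.

Set Implicit Arguments.
Unset Strict Implicit.
Unset Printing Implicit Defensive.

Import Order.TTheory GRing.Theory Num.Theory.
Import numFieldNormedType.Exports.

Local Open Scope classical_set_scope.
Local Open Scope ring_scope.

(** Write W for an invertible matrix that diagonalizes both covariances at once:
Sigma0 = W W^T and Sigma1 = W diag(l) W^T. The numbers l_i are the eigenvalues
of S Sigma1 S with S = Sigma0^(-1/2), so that C <= l_i and
|| S (Sigma1 - Sigma0) S ||_F^2 = sum_i (l_i - 1)^2
([simultaneous_diagonalization]). The divergence is at most
1/2 sum_i (l_i - 1 - ln l_i), and the first inequality follows term by term from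
x - 1 - ln x <= (x - 1)^2 / (2 c^2), valid for x >= c when 0 < c <= 1
([sub_ln_le_sqr]).

The bound on the divergence comes from the exponential moments of the
log-likelihood ratio L = ln p - ln q, where p and q are the densities of Y and
X. For t > 0, t L <= exp(t L) - 1 pointwise, so the
divergence is at most (M_t - 1) / t, where M_t = int exp(t L) p = int p^(1+t)
q^(-t) is the exponential moment that defines the Renyi divergence of order
1 + t ([kl_div_le_renyi]). For Gaussian densities p^(1+t) q^(-t) is, up to a
constant, a Gaussian function with precision matrix
(1 + t) Sigma1^(-1) - t Sigma0^(-1), which is positive definite for small t. So
M_t is given by the Gaussian integral ([gaussian_integral]) as an explicit
product over the l_i ([gaussian_renyi]); the announced bound is the right
derivative of M_t at t = 0 ([le_renyi_limit]).

For the second inequality let B = Sigma0^(-1) Sigma1 - 1. The trace is invariant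
under cyclic permutation, so || S (Sigma1 - Sigma0) S ||_F^2 = tr(B B), which is
at most tr(B B^T) = || B ||_F^2 because 2 b_ij b_ji <= b_ij^2 + b_ji^2. *)

(** * Spectral theorem for real symmetric matrices *)

(** Over the complex numbers a real symmetric matrix is Hermitian, hence
unitarily diagonalizable with a real spectrum. Being an eigenvalue means being a
root of the characteristic polynomial, so a real complex eigenvalue is already
an eigenvalue over the base field. *)
Lemma symmetric_eigenvalue (R : rcfType) n (A : 'M[R]_n.+1) :
  A^T = A -> exists a, eigenvalue A a.
Proof.
move=> symA; pose B := map_mx (real_complex R) A.
have hermB : B \is hermsymmx.
  apply: realsym_hermsym.
    apply/is_hermitianmxP; rewrite expr0 scale1r map_mx_id//.
    by rewrite /B matrix.map_trmx symA.
  by apply/mxOverP => i j; rewrite mxE; apply/complex_realP; exists (A i j).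
have BE := orthomx_spectralP (hermitian_normalmx hermB).
have realB := hermitian_spectral_diag_real hermB.
set P := spectralmx B in BE; set d := spectral_diag B in BE realB.
have [a da] : exists a : R, d 0 0 = real_complex R a.
  have /complex_realP[a da] : d 0 0 \is Num.real by exact: (mxOverP realB).
  by exists a.
exists a; rewrite eigenvalue_root_char -(fmorph_root (real_complex R)).
rewrite map_char_poly -eigenvalue_root_char -[X in eigenvalue _ X]da.
have Pu : P \in unitmx by exact: spectral_unit.
apply/eigenvalueP; exists (row 0 P).
  rewrite -/B BE !mulmxA -row_mul mulmxV// -row_mul mul1mx row_diag_mx.
  by rewrite -scalemxAl -rowE.
apply/eqP => P0; move: (mulmxV Pu) => /(congr1 (row 0)).
rewrite row_mul P0 mul0mx => /rowP/(_ 0); rewrite !mxE eqxx => /eqP.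
by rewrite eq_sym oner_eq0.
Qed.

Lemma row_mul_trE (R : comNzRingType) n (v : 'rV[R]_n) :
  (v *m v^T) 0 0 = \sum_i v 0 i ^+ 2.
Proof. by rewrite mxE; apply: eq_bigr => i _; rewrite mxE expr2. Qed.

Lemma row_mul_tr_gt0 (R : realDomainType) n (v : 'rV[R]_n) :
  v != 0 -> 0 < (v *m v^T) 0 0.
Proof.
move=> v0; rewrite row_mul_trE lt0r sumr_ge0 ?andbT; last first.
  by move=> i _; exact: sqr_ge0.
apply: contra v0; rewrite psumr_eq0 => [/allP v0|? _]; last exact: sqr_ge0.
apply/eqP/rowP => i; rewrite mxE; apply/eqP; rewrite -sqrf_eq0.
exact: v0 (mem_index_enum i).
Qed.

(** The Householder reflection in the hyperplane orthogonal to e - v exchanges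
the unit vectors e and v. *)
Lemma householder (R : realFieldType) n (e v : 'rV[R]_n) :
  e *m e^T = 1%:M -> v *m v^T = 1%:M ->
  exists2 H : 'M[R]_n, H^T = H /\ H *m H = 1%:M & e *m H = v.
Proof.
move=> e1 v1; have [->|ev] := eqVneq e v.
  by exists 1%:M; rewrite ?mulmx1// trmx1.
have [w wE] : exists w, w = e - v by exists (e - v).
have s_gt0 : 0 < (w *m w^T) 0 0 by rewrite row_mul_tr_gt0// wE subr_eq0.
move sE : ((w *m w^T) 0 0) => s in s_gt0.
have cs : 2 / s * s = 2 by rewrite divfK ?gt_eqF.
exists (1%:M - (2 / s) *: (w^T *m w)).
  split; first by rewrite linearB/= linearZ/= trmx1 trmx_mul trmxK.
  have WW : (w^T *m w) *m (w^T *m w) = s *: (w^T *m w).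
    rewrite mulmxA -(mulmxA w^T) [w *m _]mx11_scalar sE mul_mx_scalar.
    by rewrite scalemxAl.
  rewrite mulmxBl mul1mx mulmxBr mulmx1 -scalemxAl -scalemxAr WW !scalerA.
  rewrite -mulrA cs.
  by apply/matrixP => i j; rewrite !mxE; ring.
rewrite mulmxBr mulmx1 -scalemxAr mulmxA.
have ewE : 2 * (e *m w^T) 0 0 = s.
  have veE : (v *m e^T) 0 0 = (e *m v^T) 0 0.
    by rewrite -[in RHS](trmxK e) -trmx_mul [RHS]mxE.
  rewrite -sE wE linearB/= !mulmxBr !mulmxBl e1 v1.
  move: veE; set x := (v *m e^T); set y := (e *m v^T); rewrite !mxE /= => ->.
  lra.
rewrite [e *m w^T]mx11_scalar mul_scalar_mx scalerA mulrAC ewE.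
by rewrite mulfV ?gt_eqF// scale1r wE subKr.
Qed.

(** Conjugation by a reflection that sends the first basis vector to a unit
eigenvector splits off a 1 x 1 block, and the remaining block is symmetric. *)
Lemma spectral_symmetric (R : rcfType) n (A : 'M[R]_n) : A^T = A ->
  exists P : 'M[R]_n, exists d : 'rV[R]_n,
    P *m P^T = 1%:M /\ A = P^T *m diag_mx d *m P.
Proof.
elim: n A => [|n IHn] A symA.
  by exists 0, 0; split; apply/matrixP => -[].
have [a /eigenvalueP[u uA u0]] := symmetric_eigenvalue symA.
pose v := (Num.sqrt ((u *m u^T) 0 0))^-1 *: u.
have v1 : v *m v^T = 1%:M.
  rewrite /v linearZ/= -scalemxAl -scalemxAr scalerA -invfM -expr2.
  rewrite sqr_sqrtr ?ltW ?row_mul_tr_gt0// [X in _ *: X]mx11_scalar.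
  by rewrite scale_scalar_mx mulVf// gt_eqF ?row_mul_tr_gt0.
have vA : v *m A = a *: v by rewrite -scalemxAl uA !scalerA mulrC.
pose e : 'rV[R]_n.+1 := delta_mx 0 0.
have e1 : e *m e^T = 1%:M.
  by rewrite trmx_delta mul_delta_mx; apply/matrixP => i j; rewrite !ord1 !mxE.
have [H [symH HH] eH] := householder e1 v1.
have [B BE] : exists B : 'M[R]_(1 + n), B = H *m A *m H by exists (H *m A *m H).
have symB : B^T = B by rewrite BE !trmx_mul symA symH mulmxA.
have eB : e *m B = a *: e.
  by rewrite BE !mulmxA eH vA -scalemxAl -eH -mulmxA HH mulmx1.
have B0 j : B (lshift n 0) j = a * (j == lshift n 0)%:R.
  have -> : lshift n 0 = 0 :> 'I_(1 + n) by exact/val_inj.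
  by have /rowP/(_ j) := eB; rewrite -rowE !mxE eqxx.
have symB' : (drsubmx B)^T = drsubmx B by rewrite trmx_drsub symB.
have [P' [d [P'1 B'E]]] := IHn _ symB'.
have Bblock : B = block_mx a%:M 0 0 (drsubmx B).
  have ur0 : ursubmx B = 0.
    by apply/rowP => j; rewrite !mxE B0 eq_rlshift mulr0.
  rewrite -[LHS]submxK; congr block_mx.
  - apply/matrixP => i j; rewrite !ord1 !mxE B0 eqxx mulr1.
    by rewrite eqxx mulr1n.
  - exact: ur0.
  - by rewrite -symB -trmx_ursub ur0 trmx0.
pose P : 'M[R]_(1 + n) := block_mx 1%:M 0 0 P'.
have P1 : P *m P^T = 1%:M.
  rewrite /P tr_block_mx mulmx_block !trmx0 !trmx1 !mulmx0 !mul0mx !mulmx1 P'1.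
  by rewrite !addr0 add0r -scalar_mx_block.
exists (P *m H), (row_mx a%:M d); split.
  by rewrite trmx_mul mulmxA -(mulmxA P) symH HH mulmx1.
have diagE : diag_mx (row_mx a%:M d) = block_mx a%:M 0 0 (diag_mx d).
  rewrite diag_mx_row; congr block_mx.
  by apply/matrixP => i j; rewrite !ord1 !mxE.
have PDP : P^T *m diag_mx (row_mx a%:M d) *m P = B.
  rewrite diagE /P tr_block_mx !mulmx_block !trmx0 !trmx1.
  rewrite !mulmx0 !mul0mx !mulmx1 !mul1mx !addr0 !add0r mul0mx -B'E.
  by rewrite -Bblock.
rewrite trmx_mul !mulmxA symH -(mulmxA H) -(mulmxA H) PDP BE.
by rewrite !mulmxA HH mul1mx -mulmxA HH mulmx1.
Qed.

(** * Positive definite matrices *)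

Lemma quad_diag (R : comNzRingType) m n (B : 'M[R]_(m, n)) (d : 'rV[R]_m)
    (x : 'cV[R]_n) :
  (x^T *m (B^T *m diag_mx d *m B) *m x) 0 0 = \sum_i d 0 i * (B *m x) i 0 ^+ 2.
Proof.
rewrite -!mulmxA !mulmxA -trmx_mul -mulmxA mxE; apply: eq_bigr => i _.
by rewrite mul_mx_diag !mxE expr2 mulrA [_ * d 0 i]mulrC.
Qed.

Lemma posdefmx_congr_diag (R : realType) n (B : 'M[R]_n) (d : 'rV[R]_n) :
  B \in unitmx -> (forall i, 0 < d 0 i) -> posdefmx (B^T *m diag_mx d *m B).
Proof.
move=> Bu d_gt0; split; first by rewrite !trmx_mul trmxK tr_diag_mx mulmxA.
move=> x x0; rewrite quad_diag lt0r sumr_ge0 ?andbT; last first.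
  by move=> i _; rewrite mulr_ge0 ?sqr_ge0// ltW.
apply: contra x0; rewrite psumr_eq0; last first.
  by move=> i _; rewrite mulr_ge0 ?sqr_ge0// ltW.
move=> /allP Bx0; rewrite -[x](mulKmx Bu).
suff -> : B *m x = 0 by rewrite mulmx0.
apply/colP => i; rewrite [RHS]mxE; apply/eqP; rewrite -sqrf_eq0.
by have /eqP/eqP := Bx0 i (mem_index_enum i); rewrite mulf_eq0 gt_eqF.
Qed.

(** The i-th row of P is a unit eigenvector, at which the quadratic form takes
the value d_i. Bounds on the form thus become bounds on the spectrum. *)
Lemma spectral_quad (R : comUnitRingType) n (P : 'M[R]_n) (d : 'rV[R]_n) i :
  P *m P^T = 1%:M -> let x := col i P^T in
  (x^T *m (P^T *m diag_mx d *m P) *m x) 0 0 = d 0 i /\ (x^T *m x) 0 0 = 1.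
Proof.
move=> P1 x; have Px : P *m x = delta_mx i 0.
  by rewrite /x colE mulmxA P1 mul1mx.
have xx : x^T *m x = 1%:M.
  rewrite -[X in _ *m X]mul1mx -(mulmx1C P1) -(mulmxA P^T) mulmxA -trmx_mul Px.
  rewrite trmx_delta mul_delta_mx.
  by apply/matrixP => ? ?; rewrite !ord1 !mxE.
split; last by rewrite xx mxE eqxx.
rewrite quad_diag Px (bigD1 i)//= big1 => [|j ji]; rewrite !mxE eqxx.
  by rewrite eqxx expr1n mulr1 addr0.
by rewrite (negPf ji) expr0n mulr0.
Qed.

Lemma spectral_posdefmx (R : realType) n (A : 'M[R]_n) : posdefmx A ->
  exists P : 'M[R]_n, exists d : 'rV[R]_n,
    [/\ P *m P^T = 1%:M, A = P^T *m diag_mx d *m P & forall i, 0 < d 0 i].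
Proof.
move=> [/spectral_symmetric[P [d [P1 AE]]] A_gt0].
exists P, d; split => // i.
have [<- xx] := spectral_quad d i P1; rewrite -AE; apply: A_gt0.
apply/eqP => x0; move: xx; rewrite x0 mulmx0 mxE => /esym/eqP.
by rewrite oner_eq0.
Qed.

Lemma det_posdefmx_gt0 (R : realType) n (A : 'M[R]_n) :
  posdefmx A -> 0 < \det A.
Proof.
move=> /spectral_posdefmx[P [d [P1 -> d_gt0]]].
rewrite !det_mulmx mulrAC -det_mulmx (mulmx1C P1) det1 mul1r det_diag.
exact: prodr_gt0.
Qed.

Lemma posdefmx_unit (R : realType) n (A : 'M[R]_n) :
  posdefmx A -> A \in unitmx.
Proof. by move=> /det_posdefmx_gt0 A0; rewrite unitmxE unitfE gt_eqF. Qed.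

(** Replacing every eigenvalue by its square root gives a positive semidefinite
square root, so the choice made by [sqrtmx] is not the default value. *)
Lemma sqrtmx_posdef (R : realType) n (A : 'M[R]_n) : posdefmx A ->
  (sqrtmx A)^T = sqrtmx A /\ sqrtmx A *m sqrtmx A = A.
Proof.
move=> /spectral_posdefmx[P [d [P1 AE d_gt0]]].
pose r : 'rV[R]_n := \row_i Num.sqrt (d 0 i).
suff /(@xgetPex _ 0) : [set S : 'M[R]_n | possemidefmx S /\ S *m S = A] !=set0.
  by move=> [[]].
exists (P^T *m diag_mx r *m P); split; first split.
- by rewrite !trmx_mul trmxK tr_diag_mx mulmxA.
- move=> x; rewrite quad_diag sumr_ge0// => i _.
  by rewrite mulr_ge0 ?sqr_ge0// mxE sqrtr_ge0.
- rewrite AE !mulmxA -(mulmxA _ P) P1 mulmx1 -(mulmxA P^T); congr (_ *m _ *m _).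
  apply/matrixP => i j; rewrite mul_diag_mx !mxE mulrnAr.
  by rewrite -expr2 sqr_sqrtr// ltW.
Qed.

(** With Q = sqrt A and S = Q^(-1), an orthogonal diagonalization
S B S = U^T diag(l) U gives W = Q U^T. *)
Lemma simultaneous_diagonalization (R : realType) n (A B : 'M[R]_n) (c : R) :
  posdefmx A -> B^T = B -> loewner_le (c *: A) B ->
  exists W : 'M[R]_n, exists l : 'rV[R]_n,
  let S := invmx (sqrtmx A) in
  [/\ W \in unitmx, A = W *m W^T, B = W *m diag_mx l *m W^T,
    forall i, c <= l 0 i &
    frobenius_norm (S *m (B - A) *m S) ^+ 2 = \sum_i (l 0 i - 1) ^+ 2].
Proof.
move=> pA symB [_ AB]; have [symQ QQ] := sqrtmx_posdef pA.
move: (sqrtmx A) symQ QQ => Q symQ QQ.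
have Qu : Q \in unitmx.
  by have := posdefmx_unit pA; rewrite -QQ unitmx_mul andbb.
pose S := invmx Q; have symS : S^T = S by rewrite trmx_inv symQ.
have SQ : S *m Q = 1%:M by exact: mulVmx.
have QS : Q *m S = 1%:M by exact: mulmxV.
pose G := S *m B *m S.
have symG : G^T = G by rewrite !trmx_mul symS symB mulmxA.
have [U [l [U1 GE]]] := spectral_symmetric symG.
have U2 := mulmx1C U1.
exists (Q *m U^T), l; split.
- by rewrite unitmx_mul Qu unitmx_tr; have [] := mulmx1_unit U1.
- by rewrite trmx_mul trmxK symQ mulmxA -(mulmxA Q) U2 mulmx1 QQ.
- rewrite trmx_mul trmxK symQ !mulmxA -!(mulmxA Q) -GE.
  by rewrite /G !mulmxA QS mul1mx -mulmxA SQ mulmx1.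
(* The Loewner hypothesis, tested at S y for y the i-th eigenvector of S B S,
   says that l_i - c is nonnegative. *)
- move=> i; have [] := spectral_quad l i U1; set y := col i U^T.
  rewrite -GE => lE y1.
  have := AB (S *m y).
  rewrite trmx_mul symS mulmxBr mulmxBl !mulmxA.
  rewrite -scalemxAr -!scalemxAl -QQ !mulmxA -(mulmxA _ S Q) SQ mulmx1.
  rewrite -(mulmxA _ Q S) QS mulmx1.
  have -> : y^T *m S *m B *m S *m y = y^T *m G *m y by rewrite /G !mulmxA.
  rewrite [y^T *m G *m y]mx11_scalar [y^T *m y]mx11_scalar lE y1.
  by rewrite !mxE mulr1 subr_ge0.
- have -> : S *m (B - A) *m S = U^T *m (diag_mx l - 1%:M) *m U.
    rewrite mulmxBr mulmxBl -/G GE -QQ mulmxBr mulmxBl mulmx1 U2.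
    by rewrite -!mulmxA QS mulmx1 SQ.
  have -> : diag_mx l - 1%:M = diag_mx (l - const_mx 1).
    by rewrite linearB/= diag_const_mx.
  set D := diag_mx _; have trE : \tr (U^T *m D *m U *m (U^T *m D *m U)^T) =
      \sum_i (l 0 i - 1) ^+ 2.
    rewrite !trmx_mul trmxK tr_diag_mx !mulmxA -(mulmxA _ U U^T) U1 mulmx1.
    rewrite mxtrace_mulC !mulmxA U1 mul1mx mulmx_diag mxtrace_diag.
    by apply: eq_bigr => i _; rewrite !mxE expr2.
  by rewrite /frobenius_norm trE sqr_sqrtr// sumr_ge0// => i _; exact: sqr_ge0.
Qed.

(** Summing 2 a_ij a_ji <= a_ij^2 + a_ji^2 over all i, j. *)
Lemma mxtrace_sqr_le (R : realFieldType) n (A : 'M[R]_n) :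
  \tr (A *m A) <= \tr (A *m A^T).
Proof.
have -> : \tr (A *m A^T) = \sum_i \sum_j A i j ^+ 2.
  apply: eq_bigr => i _; rewrite mxE; apply: eq_bigr => j _.
  by rewrite mxE expr2.
rewrite -(@ler_pM2l _ 2)// !mulr_natl [leRHS]mulr2n.
rewrite [X in _ <= _ + X]exchange_big/= -big_split/= -sumrMnl.
apply: ler_sum => i _; rewrite mxE -big_split/= -sumrMnl.
by apply: ler_sum => j _; have := sqr_ge0 (A i j - A j i); rewrite mulr2n; lra.
Qed.

(** * The Gaussian integral *)

Definition quadf (R : realType) n (A : 'M[R]_n) (mu : 'cV[R]_n)
    (x : n.-tuple R) : R :=
  ((col_of_tuple x - mu)^T *m A *m (col_of_tuple x - mu)) 0 0.

Lemma measurable_quadf (R : realType) n (A : 'M[R]_n) (mu : 'cV[R]_n) :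
  measurable_fun [set: n.-tuple (measurableTypeR R)] (quadf A mu).
Proof.
have -> : quadf A mu = fun x =>
    \sum_j (\sum_i (tnth x i - mu i 0) * A i j) * (tnth x j - mu j 0).
  apply/funext => x; rewrite /quadf mxE; apply: eq_bigr => j _.
  by rewrite !mxE; congr (_ * _); apply: eq_bigr => i _; rewrite !mxE.
apply: measurable_sum => j; apply: measurable_funM.
  apply: measurable_sum => i; apply: measurable_funM => //.
  by apply: measurable_funB => //; exact: measurable_tnth.
by apply: measurable_funB => //; exact: measurable_tnth.
Qed.

Lemma gaussian_integral1 (R : realType) (a m : R) : 0 < a ->
  (\int[@lebesgue_measure R]_x (expR (- (a * (x - m) ^+ 2) / 2))%:E =
   (Num.sqrt (2 * pi / a))%:E)%E.
Proof.
move=> a_gt0; pose s := (Num.sqrt a)^-1.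
have s2 : s ^+ 2 = a^-1 by rewrite /s exprVn sqr_sqrtr// ltW.
have s0 : s != 0 by rewrite /s invr_eq0 gt_eqF// sqrtr_gt0.
have pk : normal_peak s = (Num.sqrt (2 * pi / a))^-1.
  by rewrite /normal_peak s2 -mulr_natr; congr (Num.sqrt _)^-1; ring.
have pk0 : Num.sqrt (2 * pi / a) != 0.
  by rewrite gt_eqF// sqrtr_gt0 divr_gt0// mulr_gt0// pi_gt0.
transitivity (\int[@lebesgue_measure R]_x
    ((Num.sqrt (2 * pi / a))%:E * (normal_pdf m s x)%:E))%E.
  apply: eq_integral => x _; rewrite -EFinM normal_pdfE// pk. rewrite mulVKf//.
  by congr (expR _)%:E; rewrite s2 -mulr_natr; field; rewrite gt_eqF.
rewrite ge0_integralZl//.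
- by rewrite integral_normal_pdf mule1.
- by apply/measurable_EFinP; exact: measurable_normal_pdf.
- by move=> x _; rewrite lee_fin normal_pdf_ge0.
Qed.

Lemma col_of_tuple_tcons (R : realType) n (x : R) (y : n.-tuple R) :
  col_of_tuple (tcons (x, y)) = col_mx x%:M (col_of_tuple y).
Proof.
apply/(@colP _ (1 + n)) => i; rewrite mxE.
have [[j|j] ->] : exists u, i = unsplit u.
  by exists (fintype.split i); rewrite splitK.
  by rewrite col_mxEu !ord1 !mxE eqxx.
rewrite /= col_mxEd mxE.
rewrite (_ : rshift 1 j = lift ord0 j :> 'I_n.+1); last exact/val_inj.
by rewrite tnthS.
Qed.


(** Completing the square in the first coordinate; the other coordinates are
left with the Schur complement of a. *)
Lemma complete_square (R : fieldType) n (a : R) (b : 'cV[R]_n) (D : 'M[R]_n)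
    (s : R) (y : 'cV[R]_n) : a != 0 ->
  ((col_mx s%:M y)^T *m block_mx a%:M b^T b D *m col_mx s%:M y) 0 0 =
  a * (s + (b^T *m y) 0 0 / a) ^+ 2 +
  (y^T *m (D - a^-1 *: (b *m b^T)) *m y) 0 0.
Proof.
move=> a0; have ybE : y^T *m b = (b^T *m y)^T by rewrite trmx_mul trmxK.
rewrite tr_col_mx mul_row_block mul_row_col tr_scalar_mx ybE.
rewrite mulmxBr mulmxBl -scalemxAr -scalemxAl !mulmxA ybE.
rewrite -(mulmxA _ b^T y) !mulmxDl -(mulmxA s%:M b^T y) [b^T *m y]mx11_scalar.
move: (b^T *m y) => B; move: (y^T *m D *m y) => Z.
rewrite tr_scalar_mx !mul_mx_scalar.
by rewrite !mxE !eqxx !mulr1n; field.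
Qed.

(** By [complete_square] the Schur complement takes at y the value of the whole
form at (s, y), where s is chosen to cancel the square. The determinant formula
is the block LU factorization. *)
Lemma posdef_schur (R : realType) n (a : R) (b : 'cV[R]_n) (D : 'M[R]_n) :
  posdefmx (block_mx a%:M b^T b D) ->
  [/\ 0 < a, posdefmx (D - a^-1 *: (b *m b^T)) &
    \det (block_mx a%:M b^T b D) = a * \det (D - a^-1 *: (b *m b^T))].
Proof.
move=> [symA A_gt0]; have a_gt0 : 0 < a.
  have := A_gt0 (col_mx 1%:M 0); rewrite tr_col_mx mul_row_block mul_row_col.
  rewrite trmx0 trmx1 !mul0mx !mul1mx !addr0 mulmx0 mulmx1 addr0 mxE eqxx.
  apply.
  apply/eqP => /(congr1 usubmx); rewrite col_mxKu => /matrixP/(_ 0 0).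
  by rewrite !mxE => /eqP; rewrite oner_eq0.
have a0 : a != 0 by rewrite gt_eqF.
split=> //.
  split.
    move: symA; rewrite tr_block_mx => /eq_block_mx[_ _ _ symD].
    by rewrite linearB/= linearZ/= trmx_mul trmxK symD.
  move=> y y0; have := A_gt0 (col_mx (- ((b^T *m y) 0 0 / a))%:M y).
  rewrite complete_square// addNr expr0n mulr0 add0r; apply.
  apply: contra y0 => /eqP/(congr1 dsubmx); rewrite col_mxKd => ->.
  by rewrite linear0.
have -> : block_mx a%:M b^T b D = block_mx 1%:M 0 (a^-1 *: b) 1%:M *m
    block_mx a%:M b^T 0 (D - a^-1 *: (b *m b^T)).
  rewrite mulmx_block !mul1mx !mul0mx !addr0.
  by rewrite mul_mx_scalar scalerA mulfV// scale1r -scalemxAl addrC subrK.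
by rewrite det_mulmx det_lblock det_ublock !det1 !mul1r det_scalar expr1.
Qed.

Lemma measurable_gaussian (R : realType) n (A : 'M[R]_n) (mu : 'cV[R]_n) :
  measurable_fun [set: n.-tuple (measurableTypeR R)]
    (fun x => (expR (- (quadf A mu x) / 2))%:E).
Proof.
apply/measurable_EFinP; apply: measurableT_comp => //.
apply: measurable_funM => //; apply: measurable_funN.
exact: measurable_quadf.
Qed.

(** Induction on the dimension. Integrating first over one coordinate, the
completed square contributes a translated one-dimensional Gaussian integral,
whose value does not depend on the translation; what is left is the integral for
the Schur complement. *)
Lemma gaussian_integral (R : realType) n (A : 'M[R]_n) (mu : 'cV[R]_n) :
  posdefmx A ->
  (\int[@lebesgue_tuple R n]_x (expR (- (quadf A mu x) / 2))%:E =
   (Num.sqrt ((2 * pi) ^+ n / \det A))%:E)%E.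
Proof.
elim: n A mu => [|n IHn] A mu pA.
  rewrite /= integral_dirac//; last exact: measurable_gaussian.
  rewrite diracT mul1e expr0 det_mx00 divr1 sqrtr1.
  by rewrite /quadf mxE big_ord0 oppr0 mul0r expR0.
pose a : R := A 0 0.
pose b : 'cV[R]_n := @dlsubmx R 1 n 1 n A.
pose D : 'M[R]_n := @drsubmx R 1 n 1 n A.
have AE : A = block_mx a%:M b^T b D :> 'M[R]_(1 + n).
  have [symA _] := pA; rewrite -[LHS](@submxK _ 1 n 1 n); congr block_mx => //.
    apply/matrixP => i j; rewrite !ord1 !mxE eqxx mulr1n /a.
    by congr (A _ _); exact/val_inj.
  by rewrite /b trmx_dlsub symA.
have : posdefmx (block_mx a%:M b^T b D : 'M[R]_(1 + n)) by rewrite -AE.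
move=> /posdef_schur[a_gt0 pS detA].
set S := (D - _) in pS detA.
pose m0 := mu 0 0; pose mu' : 'cV[R]_n := @dsubmx R 1 n 1 mu.
have quadE x y : quadf A mu (tcons (x, y)) =
    a * (x - (m0 - (b^T *m (col_of_tuple y - mu')) 0 0 / a)) ^+ 2 +
    quadf S mu' y.
  rewrite /quadf col_of_tuple_tcons.
  have -> : (col_mx x%:M (col_of_tuple y) : 'cV[R]_(1 + n)) - mu =
      col_mx (x - m0)%:M (col_of_tuple y - mu').
    rewrite -[X in _ - X](@vsubmxK _ 1 n 1) opp_col_mx add_col_mx.
    congr col_mx; apply/matrixP => i j; rewrite !ord1 !mxE eqxx !mulr1n.
    by congr (_ - mu _ _); exact/val_inj.
  rewrite AE complete_square ?gt_eqF//; congr (a * _ ^+ 2 + _).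
  by rewrite opprB addrA addrAC.
have mA := measurable_gaussian A mu.
rewrite ge0_integral_pushforward//=; last exact: measurable_tcons.
rewrite fubini_tonelli2//=; last first.
  exact: measurableT_comp mA (@measurable_tcons R n).
rewrite /fubini_G /=.
under eq_integral => y _.
  under eq_integral => x _.
    rewrite quadE opprD mulrDl expRD EFinM.
  over.
  rewrite ge0_integralZr//=; last first.
    apply/measurable_EFinP; apply: measurableT_comp => //.
    apply: measurable_funM => //; apply: measurable_funN.
    apply: measurable_funM => //; apply: measurable_funX.
    exact: measurable_funB.
  rewrite gaussian_integral1//.
over.
rewrite /= ge0_integralZl//; last exact: measurable_gaussian.
have pi2_gt0 : 0 < 2 * pi :> R by rewrite mulr_gt0// pi_gt0.
rewrite IHn// -EFinM -sqrtrM; last by rewrite divr_ge0// ltW.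
have detS := det_posdefmx_gt0 pS.
rewrite [\det A](_ : _ = a * \det S); last by rewrite -detA -AE.
congr (Num.sqrt _)%:E; rewrite exprS; field.
by rewrite !gt_eqF.
Qed.

(** * Kullback-Leibler divergence between measures with densities *)

Lemma measurable_lne_fin_num d (T : measurableType d) (R : realType)
    (f : T -> \bar R) :
  (forall x, f x \is a fin_num) -> measurable_fun setT f ->
  measurable_fun setT (fun x => lne (f x)).
Proof.
move=> ffin mf.
rewrite (_ : (fun x => _) = (fun x =>
    if fine (f x) <= 0 then -oo%E else (ln (fine (f x)))%:E)); last first.
  by apply/funext => x; rewrite -{1}(fineK (ffin x)).
have mff : measurable_fun setT (fun x => fine (f x)) by exact: measurableT_comp.
apply: measurable_fun_ifT => //; first exact: measurable_fun_ler.
by apply/measurable_EFinP; exact: measurableT_comp.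
Qed.

Section densities.
Context d (T : measurableType d) (R : realType)
  (lam : {sigma_finite_measure set T -> \bar R}).

Lemma density_dominated (P : probability T R) (p : T -> R) :
  measurable_fun setT p ->
  (forall A, measurable A -> P A = (\int[lam]_(x in A) (p x)%:E)%E) ->
  P `<< lam.
Proof.
move=> mp PE; apply/null_content_dominatesP => A mA A0.
rewrite PE// null_set_integral//.
by apply: measurable_funTS; exact/measurable_EFinP.
Qed.

Lemma dominated_by_positive_density (Q : probability T R) (q : T -> R) :
  measurable_fun setT q -> (forall x, 0 < q x) ->
  (forall A, measurable A -> Q A = (\int[lam]_(x in A) (q x)%:E)%E) ->
  lam `<< Q.
Proof.
move=> mq q0 QE; apply/null_content_dominatesP => A mA QA0.
have qA0 := etrans (esym (QE A mA)) QA0.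
have mqA : measurable_fun A (EFin \o q).
  by apply: measurable_funTS; exact/measurable_EFinP.
have : (\int[lam]_(x in A) `|(EFin \o q) x| = 0)%E.
  rewrite -[RHS]qA0; apply: eq_integral => x _.
  by rewrite gee0_abs// lee_fin ltW.
move=> /(ae_eq_integral_abs lam mA mqA)[N [mN N0 AN]].
apply/eqP; rewrite -measure_le0 -N0 le_measure ?inE// => x Ax.
by apply: AN => /(_ Ax)[/eqP]; rewrite gt_eqF.
Qed.

(** The density p agrees almost everywhere with a Radon-Nikodym derivative of P,
for which the formula is a change of variables. *)
Lemma integral_density (P : probability T R) (p : T -> R) (f : T -> \bar R) E :
  measurable_fun setT p -> (forall x, 0 <= p x) ->
  (forall A, measurable A -> P A = (\int[lam]_(x in A) (p x)%:E)%E) ->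
  (forall x, 0 <= f x)%E -> measurable E -> measurable_fun setT f ->
  (\int[P]_(x in E) f x = \int[lam]_(x in E) (f x * (p x)%:E))%E.
Proof.
move=> mp p0 PE f0 mE mf; have Plam := density_dominated mp PE.
have mg := measurable_int _ (Radon_Nikodym_SigmaFinite.f_integrable Plam).
have mp' : measurable_fun setT (EFin \o p) by exact/measurable_EFinP.
rewrite -(Radon_Nikodym_SigmaFinite.change_of_variables Plam)//; last first.
  exact: measurable_funTS.
apply: ge0_ae_eq_integral => //.
- by apply: measurable_funTS; exact: emeasurable_funM.
- by apply: measurable_funTS; exact: emeasurable_funM.
- by move=> x _; rewrite mule_ge0 ?Radon_Nikodym_SigmaFinite.f_ge0.
- by move=> x _; rewrite mule_ge0 ?lee_fin.
- apply: ae_eqe_mul2l; apply: ae_eq_subset (@subsetT _ E) _.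
  apply: integral_ae_eq => //.
    exact: Radon_Nikodym_SigmaFinite.f_integrable.
  by move=> A _ mA; rewrite -Radon_Nikodym_SigmaFinite.f_integral//; exact: PE.
Qed.

(** Uniqueness of the derivative: the integral of p / q against Q over any A is
that of p against [lam], namely P A. *)
Lemma Radon_Nikodym_densities (P Q : probability T R) (p q : T -> R) :
  measurable_fun setT p -> (forall x, 0 < p x) ->
  (forall A, measurable A -> P A = (\int[lam]_(x in A) (p x)%:E)%E) ->
  measurable_fun setT q -> (forall x, 0 < q x) ->
  (forall A, measurable A -> Q A = (\int[lam]_(x in A) (q x)%:E)%E) ->
  P `<< Q /\ ae_eq Q setT (Radon_Nikodym (charge_of_finite_measure P) Q)
    (fun x => (p x / q x)%:E).
Proof.
move=> mp p0 PE mq q0 QE.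
have PQ : P `<< Q.
  apply: null_dominates_trans (density_dominated mp PE) _.
  exact: (dominated_by_positive_density mq q0 QE).
have mpq : measurable_fun setT (fun x => (p x / q x)%:E).
  rewrite (_ : (fun x => _) =
      (fun x => (p x * expR (- ln (q x)))%:E)); last first.
    by apply/funext => x; rewrite expRN lnK// posrE.
  apply/measurable_EFinP; apply: measurable_funM => //.
  apply: measurableT_comp => //; apply: measurable_funN.
  exact: measurableT_comp.
split => //; apply: integral_ae_eq => //.
  exact: Radon_Nikodym_integrable.
move=> A _ mA; rewrite -Radon_Nikodym_integral//=.
rewrite [LHS]PE// (integral_density mq _ QE)//.
- by apply: eq_integral => x _; rewrite -EFinM divfK// gt_eqF.
- by move=> x; rewrite ltW.
- by move=> x; rewrite lee_fin divr_ge0// ltW.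
Qed.

(** Integrate t L <= exp(t L) - 1. A priori the negative part
of L may have infinite integral, so positive and negative parts are compared
separately. *)
Lemma integral_le_exp_moment (P : probability T R) (L : T -> R) (t M : R) :
  0 < t -> measurable_fun setT L ->
  (\int[P]_x (expR (t * L x))%:E = M%:E)%E ->
  (\int[P]_x (L x)%:E <= ((M - 1) / t)%:E)%E.
Proof.
move=> t0 mL LM; pose g x := (expR (t * L x) - 1) / t.
have mexp : measurable_fun setT (fun x => expR (t * L x)).
  by apply: measurableT_comp => //; exact: measurable_funM.
have mg : measurable_fun setT g.
  by apply: measurable_funM => //; exact: measurable_funB.
have iexp : P.-integrable setT (EFin \o (fun x => expR (t * L x))).
  apply/integrableP; split; first exact/measurable_EFinP.
  rewrite (_ : (\int[P]_x _)%E = M%:E) ?ltry// -LM.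
  by apply: eq_integral => x _ /=; rewrite ger0_norm// expR_ge0.
have -> : ((M - 1) / t)%:E = (\int[P]_x (g x)%:E)%E.
  transitivity (\int[P]_x
      ((t^-1)%:E * ((expR (t * L x))%:E - 1%:E)))%E; last first.
    by apply: eq_integral => x _; rewrite -EFinB -EFinM mulrC.
  have i1 : P.-integrable setT (EFin \o (cst 1 : T -> R)).
    exact: finite_measure_integrable_cst.
  rewrite integralZl//; last exact: (integrableB measurableT iexp i1).
  rewrite (integralB measurableT iexp i1) LM.
  rewrite [X in (_ - X)%E](_ : _ = 1%E) ?EFinM ?EFinB 1?muleC//.
  rewrite (eq_integral (cst 1%E))// integral_cst// mul1e.
  exact: probability_setT.
have Lg x : L x <= g x.
  rewrite /g ler_pdivlMr// lerBrDl mulrC; exact: expR_ge1Dx.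
rewrite integralE [leRHS]integralE leeB//.
- apply: ge0_le_integral => //.
  + by apply: measurable_funepos; exact/measurable_EFinP.
  + by apply: measurable_funepos; exact/measurable_EFinP.
  + move=> x _; apply: (@funepos_le _ _ setT); rewrite ?inE// => y _.
    by rewrite lee_fin.
- apply: ge0_le_integral => //.
  + by apply: measurable_funeneg; exact/measurable_EFinP.
  + by apply: measurable_funeneg; exact/measurable_EFinP.
  + move=> x _; apply: (@funeneg_le _ _ setT); rewrite ?inE// => y _.
    by rewrite lee_fin.
Qed.

(** The integral in the hypothesis is that of p^(1+t) q^(-t): its logarithm
divided by t is the Renyi divergence of order 1 + t. *)
Lemma kl_div_le_renyi (P Q : probability T R) (p q : T -> R) (t M : R) :
  measurable_fun setT p -> (forall x, 0 < p x) ->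
  (forall A, measurable A -> P A = (\int[lam]_(x in A) (p x)%:E)%E) ->
  measurable_fun setT q -> (forall x, 0 < q x) ->
  (forall A, measurable A -> Q A = (\int[lam]_(x in A) (q x)%:E)%E) ->
  0 < t ->
  (\int[lam]_x (expR (t * (ln (p x) - ln (q x))) * p x)%:E = M%:E)%E ->
  (kl_div P Q <= ((M - 1) / t)%:E)%E.
Proof.
move=> mp p0 PE mq q0 QE t0 pqM.
have [PQ dPQ] := Radon_Nikodym_densities mp p0 PE mq q0 QE.
have mL : measurable_fun setT (fun x => ln (p x) - ln (q x)).
  by apply: measurable_funB; exact: measurableT_comp.
rewrite /kl_div asboolT//.
rewrite (_ : (\int[P]_x _)%E = (\int[P]_x (ln (p x) - ln (q x))%:E)%E).
  apply: integral_le_exp_moment => //; rewrite (integral_density mp _ PE)//.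
  - by move=> x; exact: ltW.
  - apply/measurable_EFinP; apply: measurableT_comp => //.
    exact: measurable_funM.
apply: ae_eq_integral => //.
- apply: measurable_lne_fin_num.
    by move=> x; exact: Radon_Nikodym_fin_num.
  by apply: measurable_int; exact: Radon_Nikodym_integrable.
- exact/measurable_EFinP.
- have [N [mN N0 dN]] := dPQ.
  exists N; split => //.
    exact: (null_content_dominatesP _ _).1 PQ _ mN N0.
  apply: subset_trans dN; apply: subsetC => x /= dx _.
  by rewrite dx// lne_EFin ?divr_gt0// ln_div ?posrE.
Qed.

End densities.

(** * Exponential moments of a Gaussian log-likelihood ratio *)

Lemma mulmx1_invmx (R : comUnitRingType) n (A B : 'M[R]_n) :
  A *m B = 1%:M -> invmx A = B.
Proof.
by move=> AB; have [Au _] := mulmx1_unit AB; rewrite -[B](mulKmx Au) AB mulmx1.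
Qed.

Lemma invmx_congr_diag (R : fieldType) n (W : 'M[R]_n) (l : 'rV[R]_n) :
  W \in unitmx -> (forall i, l 0 i != 0) ->
  invmx (W *m diag_mx l *m W^T) =
  (invmx W)^T *m diag_mx (\row_i (l 0 i)^-1) *m invmx W.
Proof.
move=> Wu l0; apply: mulmx1_invmx.
rewrite !mulmxA -(mulmxA _ W^T) -trmx_mul mulVmx// trmx1 mulmx1.
rewrite -(mulmxA W) mulmx_diag (_ : diag_mx _ = 1%:M) ?mulmx1 ?mulmxV//.
apply/matrixP => i j; rewrite !mxE; case: eqP => // ->.
by rewrite !mulr1n mulfV.
Qed.

Lemma multinormal_pdfE (R : realType) n (mu : 'cV[R]_n) (Sigma : 'M[R]_n) x :
  multinormal_pdf mu Sigma x =
  (Num.sqrt ((2 * pi) ^+ n * \det Sigma))^-1 *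
  expR (- quadf (invmx Sigma) mu x / 2).
Proof. by []. Qed.

Lemma quadfD (R : realType) n (A B : 'M[R]_n) mu x :
  quadf (A + B) mu x = quadf A mu x + quadf B mu x.
Proof. by rewrite /quadf; move: (_ - mu) => y; rewrite mulmxDr mulmxDl mxE. Qed.

Lemma quadfZ (R : realType) n a (A : 'M[R]_n) mu x :
  quadf (a *: A) mu x = a * quadf A mu x.
Proof. by rewrite /quadf -scalemxAr -scalemxAl mxE. Qed.

Lemma ln_prod (R : realType) (I : finType) (f : I -> R) : (forall i, 0 < f i) ->
  ln (\prod_i f i) = \sum_i ln (f i).
Proof.
move=> f0; rewrite -[RHS]expRK expR_sum; congr ln.
by apply: eq_bigr => i _; rewrite lnK ?posrE.
Qed.

Lemma sqrt_expR_ln (R : realType) (x : R) :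
  0 < x -> Num.sqrt x = expR (ln x / 2).
Proof.
move=> x0; rewrite -{1}(lnK x0) -[RHS]ger0_norm ?expR_ge0// -sqrtr_sqr.
by rewrite -expRM_natl; congr (Num.sqrt (expR _)); field.
Qed.

(** The product p^(1+t) q^(-t) is a constant times the Gaussian function with
precision matrix W^(-T) diag(m) W^(-1), where m_i = (1 + t) / l_i - t; the
hypothesis on t says that the m_i are positive. *)
Lemma gaussian_renyi (R : realType) n (mu : 'cV[R]_n) (W : 'M[R]_n)
    (l : 'rV[R]_n) (t : R) :
  W \in unitmx -> (forall i, 0 < l 0 i) -> (forall i, 0 < 1 + t - t * l 0 i) ->
  let p := multinormal_pdf mu (W *m diag_mx l *m W^T) in
  let q := multinormal_pdf mu (W *m W^T) in
  (\int[@lebesgue_tuple R n]_x (expR (t * (ln (p x) - ln (q x))) * p x)%:E =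
   (expR (- (\sum_i (t * ln (l 0 i) + ln (1 + t - t * l 0 i)) / 2)))%:E)%E.
Proof.
move=> Wu l0 tl0 p q.
pose V := invmx W; have Vu : V \in unitmx by rewrite unitmx_inv.
pose m : 'rV[R]_n := \row_i ((1 + t - t * l 0 i) / l 0 i).
have m0 i : 0 < m 0 i by rewrite mxE divr_gt0.
have ln0 i : l 0 i != 0 by rewrite gt_eqF.
have MV : (1 + t) *: invmx (W *m diag_mx l *m W^T) + - t *: invmx (W *m W^T) =
    V^T *m diag_mx m *m V.
  rewrite invmx_congr_diag//.
  rewrite (mulmx1_invmx (_ : _ *m (V^T *m V) = 1%:M)); last first.
    by rewrite mulmxA -(mulmxA W) -trmx_mul mulVmx// trmx1 mulmx1 mulmxV.
  have sand a D : a *: (V^T *m D *m V) = V^T *m (a *: D) *m V.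
    by rewrite -scalemxAr -scalemxAl.
  rewrite -/V (_ : V^T *m V = V^T *m 1%:M *m V); last by rewrite mulmx1.
  rewrite !sand -mulmxDl -mulmxDr.
  congr (_ *m _ *m _); apply/matrixP => i j; rewrite !mxE.
  by case: eqP => [->|]; rewrite ?mulr0n ?mulr1n ?mulr0 ?addr0//; field.
(* All factors are written as exponentials of logarithms, so that collecting the
   constants becomes a linear computation. *)
have [c cE] : exists c : R, c = (2 * pi) ^+ n by eexists.
have [w wE] : exists w, w = \det W ^+ 2 by eexists.
have c0 : 0 < c by rewrite cE exprn_gt0// mulr_gt0// pi_gt0.
have w0 : 0 < w by rewrite wE exprn_even_gt0//= -unitfE -unitmxE.
have [L LE] : exists L, L = \prod_i l 0 i by eexists.
have [K KE] : exists K, K = \prod_i (1 + t - t * l 0 i) by eexists.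
have L0 : 0 < L by rewrite LE; exact: prodr_gt0.
have K0 : 0 < K by rewrite KE; exact: prodr_gt0.
have det1 : \det (W *m diag_mx l *m W^T) = w * L.
  by rewrite !det_mulmx det_tr det_diag wE LE; ring.
have det0 : \det (W *m W^T) = w by rewrite det_mulmx det_tr wE expr2.
have detM : \det (V^T *m diag_mx m *m V) = K / (w * L).
  rewrite !det_mulmx det_tr det_diag.
  rewrite (eq_bigr (fun i => (1 + t - t * l 0 i) / l 0 i)); last first.
    by move=> i _; rewrite mxE.
  rewrite big_split/= prodfV -KE -LE det_inv wE; field.
  by rewrite gt_eqF//= -unitfE -unitmxE.
pose Q1 := quadf (invmx (W *m diag_mx l *m W^T)) mu.
pose Q0 := quadf (invmx (W *m W^T)) mu.
pose k := expR (- (t * ln L / 2) - (ln c + ln w + ln L) / 2).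
have pE x : p x = expR (- (ln c + ln w + ln L) / 2 - Q1 x / 2).
  rewrite /p multinormal_pdfE det1 -cE sqrt_expR_ln ?mulr_gt0// -expRN -expRD.
  by rewrite !lnM ?posrE ?mulr_gt0// -/(Q1 x); congr expR; ring.
have qE x : q x = expR (- (ln c + ln w) / 2 - Q0 x / 2).
  rewrite /q multinormal_pdfE det0 -cE sqrt_expR_ln ?mulr_gt0// -expRN -expRD.
  by rewrite !lnM ?posrE ?mulr_gt0// -/(Q0 x); congr expR; ring.
transitivity (\int[@lebesgue_tuple R n]_x
    (k%:E * (expR (- quadf (V^T *m diag_mx m *m V) mu x / 2))%:E))%E.
  apply: eq_integral => x _; rewrite -EFinM pE qE !expRK -MV quadfD !quadfZ.
  by rewrite -/(Q1 x) -/(Q0 x) /k -!expRD; congr (expR _)%:E; field.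
rewrite ge0_integralZl//; first last.
- by rewrite lee_fin expR_ge0.
- exact: measurable_gaussian.
rewrite gaussian_integral; last exact: posdefmx_congr_diag.
rewrite detM -cE sqrt_expR_ln ?divr_gt0 ?mulr_gt0// -EFinM -expRD.
congr (expR _)%:E.
rewrite ln_div ?posrE ?divr_gt0 ?mulr_gt0// ln_div ?posrE ?mulr_gt0//.
rewrite lnM ?posrE// -mulr_suml big_split/= -mulr_sumr -!ln_prod//.
by rewrite -LE -KE; field.
Qed.

(** * From exponential moments to the quadratic bound *)

(** The difference f of the two sides vanishes at 1 and its derivative is
(y - 1) (1/c^2 - 1/y), where the second factor is nonnegative for y >= c because
c^2 <= c. So 1 is a minimum of f on [c, +oo[. *)
Lemma sub_ln_le_sqr (R : realType) (c x : R) : 0 < c -> c <= 1 -> c <= x ->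
  x - 1 - ln x <= (x - 1) ^+ 2 / (2 * c ^+ 2).
Proof.
move=> c0 c1 cx; have x0 : 0 < x by exact: lt_le_trans cx.
pose f y := (y - 1) ^+ 2 / (2 * c ^+ 2) - (y - 1) + ln y.
pose f' y := (y - 1) * ((c ^+ 2)^-1 - y^-1).
have df (y : R) : 0 < y -> is_derive y 1 f (f' y).
  move=> y0; have dln := is_derive1_ln y0.
  apply: is_derive_eq; rewrite /f' !scaler0 /GRing.scale /=.
  by field; rewrite !gt_eqF.
have cf (a b : R) : 0 < a -> {within `[a, b], continuous f}.
  move=> a0; apply: derivable_within_continuous => y.
  rewrite in_itv/= => /andP[ay _].
  by have [] := df y (lt_le_trans a0 ay).
have c2 y : c <= y -> 0 <= (c ^+ 2)^-1 - y^-1.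
  move=> cy; rewrite subr_ge0 lef_pV2 ?posrE ?exprn_gt0 ?(lt_le_trans c0)//.
  by rewrite (le_trans _ cy)// expr2 ger_pMl.
suff : f 1 <= f x.
  by rewrite /f ln1 subrr expr0n/= mul0r !add0r oppr0; lra.
have [x1|x1] := leP x 1.
  have dfx (y : R) : y \in `]x, 1[ -> is_derive y 1 f (f' y).
    by rewrite in_itv/= => /andP[xy _]; apply: df; exact: lt_trans xy.
  have [y] := MVT_segment x1 dfx (cf _ _ x0).
  rewrite in_itv/= => /andP[xy y1] fE; rewrite -subr_le0 fE /f'.
  rewrite mulr_le0_ge0 ?subr_ge0// mulr_le0_ge0 ?subr_le0//.
  by rewrite c2// (le_trans cx).
have dfx (y : R) : y \in `]1, x[ -> is_derive y 1 f (f' y).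
  by rewrite in_itv/= => /andP[xy _]; apply: df; exact: lt_trans xy.
have [y] := MVT_segment (ltW x1) dfx (cf _ _ ltr01).
rewrite in_itv/= => /andP[y1 yx] fE; rewrite -subr_ge0 fE /f'.
rewrite mulr_ge0 ?subr_ge0 ?(ltW x1)// mulr_ge0 ?subr_ge0//.
by rewrite -subr_ge0 c2// (le_trans c1).
Qed.

(** Let t tend to 0. The exponent E of the given bound is at most t h(t), since
- ln u <= 1/u - 1 for u = 1 + t - t l_i; then exp(E) - 1 <= t h(t) exp(t h(t)),
and h is continuous at 0. *)
Lemma le_renyi_limit (R : realType) n (l : 'I_n -> R) (K : \bar R) :
  (forall t, 0 < t -> (forall i, 0 < 1 + t - t * l i) ->
    (K <= ((expR (- (\sum_i (t * ln (l i) + ln (1 + t - t * l i)) / 2)) - 1)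
      / t)%:E)%E) ->
  (K <= (\sum_i (l i - 1 - ln (l i)) / 2)%:E)%E.
Proof.
move=> Kle; pose h t := \sum_i ((l i - 1) / (1 + t - t * l i) - ln (l i)) / 2.
have Kh t : 0 < t -> (forall i, 0 < 1 + t - t * l i) ->
    (K <= (h t * expR (t * h t))%:E)%E.
  move=> t0 u0; apply: le_trans (Kle t t0 u0) _; rewrite lee_fin ler_pdivrMr//.
  have Eh : - (\sum_i (t * ln (l i) + ln (1 + t - t * l i)) / 2) <= t * h t.
    rewrite -sumrN mulr_sumr; apply: ler_sum => i _.
    move: (u0 i); set u := _ - _ => ui0.
    have : ln (1 + (u^-1 - 1)) <= u^-1 - 1.
      by apply: le_ln1Dx; rewrite ltrBrDl subrr invr_gt0.
    rewrite addrC subrK lnV ?posrE//.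
    have -> : u^-1 - 1 = t * ((l i - 1) / u).
      by rewrite /u in ui0 *; field; rewrite gt_eqF.
    lra.
  have F0 := expR_gt0 (t * h t).
  have : (1 - t * h t) * expR (t * h t) <= 1.
    by rewrite -ler_pdivlMr// div1r -expRN; exact: expR_ge1Dx.
  rewrite -ler_expR in Eh; move: (expR (t * h t)) Eh => F; nra.
have lin i : 1 + t - t * l i @[t --> (0 : R)] --> (1 : R).
  have : 1 + t - t * l i @[t --> (0 : R)] --> 1 + (0 : R) - 0 * l i.
    apply: cvgB; last by apply: cvgM => //; exact: cvg_cst.
    by apply: cvgD => //; exact: cvg_cst.
  by rewrite mul0r subr0 addr0.
have near0 : \forall t \near (0 : R)^'+, 0 < t /\ forall i, 0 < 1 + t - t * l i.
  have u0 : \forall t \near (0 : R)^'+, forall i, 0 < 1 + t - t * l i.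
    apply: filter_forall => i.
    apply: (cvgr_gt (1 : R)); last exact: ltr01.
    exact: cvg_at_right_filter (lin i).
  by near=> t; split; near: t => //; exact: nbhs_right_gt.
have hlim : h t * expR (t * h t) @[t --> (0 : R)^'+] -->
    \sum_i (l i - 1 - ln (l i)) / 2.
  apply: cvg_at_right_filter.
  have h0 : h t @[t --> (0 : R)] --> \sum_i (l i - 1 - ln (l i)) / 2.
    apply: cvg_big => [|i _]; first exact: add_continuous.
    apply: cvgM; last exact: cvg_cst.
    apply: cvgB; last exact: cvg_cst.
    rewrite -[X in _ --> X]divr1; apply: cvgM; first exact: cvg_cst.
    by apply: cvgV; [exact: oner_neq0|exact: lin].
  rewrite -[X in _ --> X]mulr1; apply: cvgM => //.
  have th0 : t * h t @[t --> (0 : R)] --> (0 : R).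
    rewrite -[X in _ --> X](mul0r (\sum_i (l i - 1 - ln (l i)) / 2)).
    exact: cvgM.
  rewrite -expR0; apply: (cvg_comp (fun t => t * h t) expR th0).
  exact: continuous_expR.
case: K Kle Kh => [k _ Kh|_ Kh|_ _]; last by rewrite leNye.
- rewrite lee_fin; apply: cvgr_to_ge hlim _.
  by apply: filterS near0 => t [t0 u0]; rewrite -lee_fin; exact: Kh.
- have [t [t0 u0]] := filter_ex near0.
  by have := Kh t t0 u0; rewrite leye_eq.
Unshelve. all: by end_near. Qed.

Lemma multinormal_pdf_gt0 (R : realType) n (mu : 'cV[R]_n) (Sigma : 'M[R]_n) x :
  posdefmx Sigma -> 0 < multinormal_pdf mu Sigma x.
Proof.
move=> pS; rewrite mulr_gt0 ?expR_gt0// invr_gt0 sqrtr_gt0.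
rewrite mulr_gt0 ?det_posdefmx_gt0//.
by rewrite exprn_gt0// mulr_gt0// pi_gt0.
Qed.

Lemma measurable_multinormal_pdf (R : realType) n (mu : 'cV[R]_n)
    (Sigma : 'M[R]_n) :
  measurable_fun [set: n.-tuple (measurableTypeR R)] (multinormal_pdf mu Sigma).
Proof.
apply: measurable_funM => //.
by have /measurable_EFinP := measurable_gaussian (invmx Sigma) mu.
Qed.

Theorem lemma2p1 (R : realType) (n : nat) (n_ge1 : (1 <= n)%N)
    (mu : 'cV[R]_n) (Sigma0 Sigma1 : 'M[R]_n)
    (dX : measure_display) (TX : measurableType dX) (PrX : probability TX R)
    (X : {RV PrX >-> n.-tuple (measurableTypeR R)})
    (dY : measure_display) (TY : measurableType dY) (PrY : probability TY R)
    (Y : {RV PrY >-> n.-tuple (measurableTypeR R)})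
    (normalX : multinormal X mu Sigma0)
    (normalY : multinormal Y mu Sigma1)
    (C : R) (C_gt0 : 0 < C) (C_le1 : C <= 1)
    (CSigma0_gt0 : posdefmx (C *: Sigma0))
    (CSigma0_le_Sigma1 : loewner_le (C *: Sigma0) Sigma1) :
  let S := invmx (sqrtmx Sigma0) in
  (kl_div (distribution PrY Y) (distribution PrX X) <=
    ((4 * C ^+ 2)^-1 *
      frobenius_norm (S *m (Sigma1 - Sigma0) *m S) ^+ 2)%:E)%E /\
  (4 * C ^+ 2)^-1 * frobenius_norm (S *m (Sigma1 - Sigma0) *m S) ^+ 2 <=
    (4 * C ^+ 2)^-1 *
      frobenius_norm (invmx Sigma0 *m Sigma1 - 1%:M) ^+ 2.
Proof.
move=> S.
have [pd0 lawX] := normalX; have [pd1 lawY] := normalY.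
have [W [l [Wu S0E S1E Cl frobE]]] :=
  simultaneous_diagonalization pd0 pd1.1 CSigma0_le_Sigma1.
have l0 i : 0 < l 0 i by exact: lt_le_trans (Cl i).
have C2_gt0 : 0 < 4 * C ^+ 2 by rewrite mulr_gt0// exprn_gt0.
split.
  rewrite frobE.
  apply: (@le_trans _ _ (\sum_i (l 0 i - 1 - ln (l 0 i)) / 2)%:E).
    apply: le_renyi_limit => t t0 u0.
    apply: (@kl_div_le_renyi _ _ _ (lebesgue_tuple R n) _ _
      (multinormal_pdf mu Sigma1) (multinormal_pdf mu Sigma0)) => //.
    - exact: measurable_multinormal_pdf.
    - by move=> x; exact: multinormal_pdf_gt0.
    - exact: measurable_multinormal_pdf.
    - by move=> x; exact: multinormal_pdf_gt0.
    - by rewrite S0E S1E; exact: gaussian_renyi.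
  rewrite lee_fin mulr_sumr; apply: ler_sum => i _.
  have := sub_ln_le_sqr C_gt0 C_le1 (Cl i).
  rewrite -[X in X <= _ -> _](@divfK _ 2)// -ler_pdivlMr//.
  move/le_trans; apply; rewrite le_eqVlt; apply/orP; left; apply/eqP.
  by field; rewrite gt_eqF.
rewrite ler_pM2l ?invr_gt0//; set B := invmx Sigma0 *m Sigma1 - 1%:M.
have [symQ QQ] := sqrtmx_posdef pd0.
have Qu : sqrtmx Sigma0 \in unitmx.
  by have := posdefmx_unit pd0; rewrite -{1}QQ unitmx_mul andbb.
have symS : S^T = S by rewrite trmx_inv symQ.
have BE : B = S *m S *m (Sigma1 - Sigma0).
  have SSE : invmx Sigma0 = S *m S.
    apply: mulmx1_invmx; rewrite -QQ -mulmxA (mulmxA _ S) mulmxV// mul1mx.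
    by rewrite mulmxV.
  by rewrite -SSE mulmxBr mulVmx// posdefmx_unit.
have symD : (Sigma1 - Sigma0)^T = Sigma1 - Sigma0.
  by rewrite linearB/= pd0.1 pd1.1.
have trE : \tr (S *m (Sigma1 - Sigma0) *m S *m
    (S *m (Sigma1 - Sigma0) *m S)^T) = \tr (B *m B).
  by rewrite !trmx_mul symS symD BE !mulmxA [LHS]mxtrace_mulC !mulmxA.
have tr_ge0 (M : 'M[R]_n) : 0 <= \tr (M *m M^T).
  apply: sumr_ge0 => i _; rewrite mxE; apply: sumr_ge0 => j _.
  by rewrite mxE -expr2 sqr_ge0.
rewrite /frobenius_norm !sqr_sqrtr// trE.
exact: mxtrace_sqr_le.
Qed.
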